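(* Let $\{p^{j_0}f_{j_0}(x),\dots,p^{j_r}f_{j_r}(x)\}$ be a generating set in standard form for an ideal $C$ of $\mathcal{R}=\frac{GR(p^a,m)[x]}{\langle f(x)\rangle}$, where $f_{j_i}(x)=h(x)^{k_{j_i}}+p\beta_{j_i}(x)$ for some $\beta_{j_i}(x)\in\mathcal{R}$. Then for $0\le e\le a-1$: - if $e<j_0$, then $T_e(C)=t$; - if $j_i\le e<j_{i+1}$, then $T_e(C)=k_{j_i}$; - if $e\ge j_r$, then $T_e(C)=k_{j_r}$.
   Context: $p$ is a prime, $a,m\ge 1$; $GR(p^a,m)$ is the Galois ring of characteristic $p^a$ with $p^{am}$ elements, with maximal ideal $\langle p\rangle$ and residue field $\mathbb{F}_{p^m}$; $\mu$ (or a bar) denotes reduction modulo $p$. $\mathcal{T}_m\subset GR(p^a,m)$ is the Teichmüller set $\{0,1,\zeta,\dots,\zeta^{p^m-2}\}$ ($\zeta$ of multiplicative order $p^m-1$), identified with $\mathbb{F}_{p^m}$. A polynomial in $GR(p^a,m)[x]$ is regular if it is not a zero divisor, primary if it generates a primary ideal, and basic irreducible if it is irreducible with irreducible reduction modulo $p$. Standing assumption: $f(x)\in GR(p^a,m)[x]$ is a monic regular primary polynomial which is not a unit, written as $f(x)=h(x)^t+p\beta(x)$ with $t\ge 1$, $h(x)$ a monic basic irreducible polynomial with $\overline{h}(x)=h(x)$ (coefficients in $\mathcal{T}_m$), $\deg\beta(x)<t\deg h(x)$. Elements of $\mathcal{R}$ are represented by polynomials of degree less than $\deg f(x)$. Torsional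 degrees: for $0\le i\le a-1$, $\mathrm{Tor}_i(C)=\{\mu(v): v\in\mathcal{R},\ p^iv\in C\}$ is an ideal of $\mathbb{F}_{p^m}[x]/\langle\overline f(x)\rangle$, hence equals $\langle h(x)^{T_i}\rangle$ for a unique $0\le T_i\le t$; $T_i(C):=T_i$. Definition. A set $G=\{p^{j_0}f_{j_0}(x),\dots,p^{j_r}f_{j_r}(x)\}\subset\mathcal{R}$, for some $0\le r\le a-1$, which generates $C$ is a generating set in standard form for $C$ if: (1) $0\le j_0<\dots<j_r\le a-1$; (2) $t>k_{j_0}>\dots>k_{j_r}\ge 0$; (3) $f_{j_i}(x)=h(x)^{k_{j_i}}+\sum_{\ell=1}^{a-1-j_i}p^{\ell}h(x)^{t_{j_i,\ell}}\alpha_{j_i,\ell}(x)$, where each $\alpha_{j_i,\ell}(x)$ is either $0$ or satisfies $\alpha_{j_i,\ell}(x)\notin\langle p,h(x)\rangle$ and $t_{j_i,\ell}\deg h(x)+\deg\alpha_{j_i,\ell}(x)<k_{j_i}\deg h(x)$; (4) $p^{j_{i+1}}f_{j_i}(x)\in\langle p^{j_{i+1}}f_{j_{i+1}}(x),\dots,p^{j_r}f_{j_r}(x)\rangle$ for $0\le i<r$; (5) $p^{j_0}f(x)\in\langle p^{j_0}f_{j_0}(x),\dots,p^{j_r}f_{j_r}(x)\rangle$ in $GR(p^a,m)[x]$. *)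

(* Defs.v *)
From HB Require Import structures.
From mathcomp Require Import all_boot all_order all_algebra.

Set Implicit Arguments.
Unset Strict Implicit.
Unset Printing Implicit Defensive.

Import GRing.Theory.
Local Open Scope ring_scope.

(* MathComp's [GRing.unit] is not available on {poly R} for a ring R with zero
   divisors, and its [idealr] only covers proper ideals. *)
Section Rings.
Variable A : comNzRingType.
Implicit Types (x y : A) (I J M : A -> Prop).

Definition is_unit x := exists y, x * y = 1.

Definition regular x := forall y, x * y = 0 -> y = 0.

Definition irreducible_elt x :=
  ~ is_unit x /\ forall y z, x = y * z -> is_unit y \/ is_unit z.

Definition is_ideal I :=
  [/\ I 0, forall x y, I x -> I y -> I (x + y) & forall x y, I y -> I (x * y)].

(* Membership in the ideal generated by the members of [s]. *)
Definition ideal_gen (s : seq A) x :=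
  exists c : nat -> A, x = \sum_(i < size s) c i * s`_i.

Definition maximal_ideal M :=
  [/\ is_ideal M, ~ M 1 &
      forall J, is_ideal J -> (forall x, M x -> J x) ->
        J 1 \/ (forall x, J x -> M x)].

Definition primary_ideal I :=
  [/\ is_ideal I, ~ I 1 &
      forall x y, I (x * y) -> I x \/ exists n, I (y ^+ n)].

Definition primary x := primary_ideal (ideal_gen [:: x]).

End Rings.

(* Up to isomorphism, GR(p^a, m) is the only ring satisfying these conditions,
   so quantifying over such R is quantifying over models of GR(p^a, m). *)
Record galois_ring (p a m : nat) (R : finComNzRingType) : Prop := GaloisRing {
  galois_prime : prime p;
  galois_a_gt0 : (0 < a)%N;
  galois_m_gt0 : (0 < m)%N;
  galois_char : forall n : nat, (n%:R == 0 :> R) = (p ^ a %| n)%N;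
  galois_card : #|R| = (p ^ (a * m))%N;
  galois_local : forall M : R -> Prop,
    maximal_ideal M <-> (forall x, M x <-> ideal_gen [:: p%:R] x)
}.

(* [mu] presents F as the residue field of R modulo p. *)
Definition reduction (p : nat) (R : finComNzRingType) (F : finFieldType)
    (mu : {rmorphism R -> F}) : Prop :=
  (forall y, exists x, mu x = y) /\
  (forall x, mu x = 0 <-> ideal_gen [:: p%:R] x).

Section Teichmuller.
Variables (p m : nat) (R : finComNzRingType) (zeta : R).

Definition teichmuller (x : R) :=
  x = 0 \/ exists2 n, (n < p ^ m - 1)%N & x = zeta ^+ n.

End Teichmuller.

Definition basic_irreducible (R : finComNzRingType) (F : finFieldType)
    (mu : {rmorphism R -> F}) (h : {poly R}) : Prop :=
  irreducible_elt h /\ irreducible_poly (map_poly mu h).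

Definition deg (R : nzRingType) (q : {poly R}) : nat := (size q).-1.

(* [{poly %/ f}] is the intended quotient R[x]/<f> because f is required below
   to be monic and not a unit, hence of positive degree. *)
Record standing_assumption (p a m : nat) (R : finComNzRingType)
    (F : finFieldType) (mu : {rmorphism R -> F}) (zeta : R)
    (f h beta : {poly R}) (t : nat) : Prop := StandingAssumption {
  standing_galois : galois_ring p a m R;
  standing_card : #|F| = (p ^ m)%N;
  standing_mu : reduction p mu;
  standing_zeta : (p ^ m - 1).-primitive_root zeta;
  standing_f_monic : f \is monic;
  standing_f_regular : regular f;
  standing_f_primary : primary f;
  standing_f_nonunit : ~ is_unit f;
  standing_t_gt0 : (0 < t)%N;
  standing_h_monic : h \is monic;
  standing_h_irr : basic_irreducible mu h;
  standing_h_teich : forall i, teichmuller p m zeta h`_i;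
  (* deg 0 is -oo, so beta = 0 is allowed *)
  standing_beta : beta = 0 \/ (deg beta < t * deg h)%N;
  standing_f : f = h ^+ t + p%:R * beta
}.

Section Torsion.
Variables (p : nat) (R : finComNzRingType) (F : finFieldType).
Variables (mu : {rmorphism R -> F}) (f h : {poly R}) (t : nat).
Implicit Type C : {poly %/ f} -> Prop.

Definition qreduce (v : {poly %/ f}) : {poly %/ map_poly mu f} :=
  in_qpoly (map_poly mu f) (map_poly mu v).

Definition Tor C (i : nat) (w : {poly %/ map_poly mu f}) : Prop :=
  exists2 v : {poly %/ f}, C ((p ^ i)%:R * v) & w = qreduce v.

(* [torsional_degree C i T] is T_i(C) = T. *)
Definition torsional_degree C (i T : nat) : Prop :=
  unique (fun T' => (T' <= t)%N /\
    forall w, Tor C i w <->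
      ideal_gen [:: in_qpoly (map_poly mu f) (map_poly mu h) ^+ T'] w) T.

End Torsion.

Section StandardForm.
Variables (p a : nat) (R : finComNzRingType) (f h : {poly R}) (t : nat).

(* The sequences are indexed by the position i <= r: [j i], [k i] and [g i]
   stand for j_i, k_{j_i} and f_{j_i}; [gens] lists the polynomials
   p^{j_l} f_{j_l} for i <= l <= r. *)
Definition gens (r : nat) (j : nat -> nat) (g : nat -> {poly R}) (i : nat) :=
  [seq (p ^ j l)%:R * g l | l <- iota i (r.+1 - i)].

Definition qgens r j g i := [seq in_qpoly f q | q <- gens r j g i].

Record standard_form (C : {poly %/ f} -> Prop) (r : nat) (j k : nat -> nat)
    (g : nat -> {poly R}) : Prop := StandardForm {
  std_r : (r <= a.-1)%N;
  std_generates : forall c, C c <-> ideal_gen (qgens r j g 0) c;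
  std_j_lt : forall i, (i < r)%N -> (j i < j i.+1)%N;
  std_j_le : (j r <= a.-1)%N;
  std_k_lt : (k 0 < t)%N;
  std_k_gt : forall i, (i < r)%N -> (k i > k i.+1)%N;
  std_form : forall i, (i <= r)%N ->
    exists (s : nat -> nat) (alpha : nat -> {poly R}),
      g i = h ^+ k i
            + \sum_(1 <= l < (a.-1 - j i).+1) (p ^ l)%:R * h ^+ s l * alpha l
      /\ forall l, (1 <= l <= a.-1 - j i)%N ->
           alpha l = 0 \/
           ~ ideal_gen [:: p%:R; h] (alpha l)
           /\ (s l * deg h + deg (alpha l) < k i * deg h)%N;
  std_chain : forall i, (i < r)%N ->
    ideal_gen (qgens r j g i.+1) (in_qpoly f ((p ^ j i.+1)%:R * g i));
  std_f : ideal_gen (gens r j g 0) ((p ^ j 0%N)%:R * f)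
}.

End StandardForm.

(* Main.v *)
Require Import Defs.
From HB Require Import structures.
From mathcomp Require Import all_boot all_order all_algebra.
From mathcomp Require Import ring.

Set Implicit Arguments.
Unset Strict Implicit.
Unset Printing Implicit Defensive.

(** Membership in an ideal C of R[x]/(f) is lifted to R[x], where it becomes
    membership in (f, p^(j 0) g_0, ..., p^(j r) g_r), and where the reduction
    modulo p lands in F[x], a unique factorization domain.  Write hbar for the
    reduction of h, so that f reduces to hbar^t and g_i to hbar^(k i), and I_i
    for the ideal of R[x] generated by the p^(j l) g_l with l >= i.

    That hbar^(k i) lies in Tor_e(C) as soon as j i <= e is seen on p^e g_i.
    The content is the converse: if p^e v lies in the lifted ideal, then
    hbar^(k i) divides the reduction of v, where i is the last index such that
    j i <= e (with hbar^t instead if e < j 0).  Everything rests on one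
    property of R: if p^e x is a multiple of p^(e+1) and e < a, then x reduces
    to 0 (p_torsion).  It implies that a polynomial with nonzero reduction can
    be cancelled modulo p^n for n <= a (p_pow_divides_cofactor).  Suppose
    p^e v = c p^(j i) g_i + z with z in I_(i+1); a further multiple of f is
    treated likewise, since if j 0 <= e its cofactor is divisible by p^(j 0), so
    that it lies in I_0 by std_f.
    - If e < j (i+1), or i = r, then z is a multiple of p^(e+1), so p^e divides
      c p^(j i), and dividing by p^e shows that the reduction of g_i divides
      that of v (p_pow_leading).
    - If j (i+1) <= e, then p^(j (i+1)) divides c p^(j i), so that p^e v lies
      in I_(i+1) provided p^(j (i+1)) g_i does; the argument is then repeated
      with i+1 (saturated_descent).

    The proviso of the second case is what std_chain says, except that
    std_chain holds modulo f only.  The multiple of f is removed by working in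
    the saturations S_i of the I_i with respect to the polynomials whose
    reduction is prime to hbar, which does not affect divisibility by powers of
    hbar.  By induction on i, p^(j i) f lies in S_i, the case i = 0 being
    std_f: say s p^(j i) f = d p^(j i) g_i modulo I_(i+1), where the reduction
    of s is prime to hbar.  Modulo I_(i+1), std_chain reads
    p^(j (i+1)) g_i = c' p^(j (i+1)) f, so that (s - d c') p^(j (i+1)) g_i lies
    in I_(i+1).  Comparing reductions in the first congruence gives
    s hbar^t = d hbar^(k i), so hbar divides the reduction of d because k i < t,
    and that of s - d c' is still prime to hbar (saturated_chain_step). *)

Import GRing.Theory.
Local Open Scope ring_scope.

Lemma leq_of_steps (j : nat -> nat) r i l :
    (forall n, (n < r)%N -> (j n < j n.+1)%N) ->
  (i <= l)%N -> (l <= r)%N -> (j i <= j l)%N.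
Proof.
move=> j_lt /subnKC <-; elim: (l - i)%N => [|d IHd]; rewrite ?addn0 // addnS.
by move=> lt_r; apply: leq_trans (IHd (ltnW lt_r)) (ltnW (j_lt _ lt_r)).
Qed.

Lemma size_map_monic (A B : nzRingType) (phi : {rmorphism A -> B})
    (q : {poly A}) : q \is monic -> size (map_poly phi q) = size q.
Proof.
by move=> /monicP lc1; rewrite size_map_poly_id0 // lc1 rmorph1 oner_neq0.
Qed.

(** * Ideals generated by finite sequences *)

Section Ideals.
Variable A : comNzRingType.
Implicit Types (x y z c d : A) (s : seq A).

Lemma ideal_gen_is_ideal s : is_ideal (ideal_gen s).
Proof.
split.
- by exists (fun=> 0); rewrite big1 // => i _; rewrite mul0r.
- move=> x y [c ->] [d ->]; exists (fun i => c i + d i).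
  by rewrite -big_split; apply: eq_bigr => i _; rewrite mulrDl.
- move=> x y [c ->]; exists (fun i => x * c i).
  by rewrite mulr_sumr; apply: eq_bigr => i _; rewrite mulrA.
Qed.

Lemma ideal_gen_cons x s y :
  ideal_gen (x :: s) y <-> exists c, exists2 z, ideal_gen s z & y = c * x + z.
Proof.
split=> [[c ->] | [c [z [d ->] ->]]].
  exists (c 0%N), (\sum_(i < size s) c i.+1 * s`_i).
    by exists (c \o succn).
  by rewrite big_ord_recl.
by exists (fun i => if i is i'.+1 then d i' else c); rewrite big_ord_recl.
Qed.

Lemma ideal_gen1 x y : ideal_gen [:: x] y <-> exists c, y = c * x.
Proof.
split=> [[c ->] | [c ->]]; first by exists (c 0%N); rewrite big_ord1.
by exists (fun=> c); rewrite big_ord1.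
Qed.

Lemma mem_ideal_gen s x : x \in s -> ideal_gen s x.
Proof.
elim: s => // y s IHs; rewrite inE => /predU1P[-> | /IHs sx]; last first.
  by apply/ideal_gen_cons; exists 0, x; rewrite // mul0r add0r.
have [s0 _ _] := ideal_gen_is_ideal s.
by apply/ideal_gen_cons; exists 1, 0; rewrite // mul1r addr0.
Qed.

Lemma ideal_gen_min (I : A -> Prop) s :
  is_ideal I -> (forall x, x \in s -> I x) -> forall x, ideal_gen s x -> I x.
Proof.
case=> I0 ID IM; elim: s => [|y s IHs] sI x.
  by case=> c ->; rewrite big_ord0.
case/ideal_gen_cons=> c [z sz ->]; apply: ID.
  by apply/IM/sI; rewrite mem_head.
by apply: IHs sz => w sw; apply: sI; rewrite inE sw orbT.
Qed.

Lemma multiples_ideal d : is_ideal (fun x => exists y, x = d * y).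
Proof.
split; first by exists 0; rewrite mulr0.
- by move=> _ _ [x ->] [y ->]; exists (x + y); rewrite mulrDr.
- by move=> x _ [y ->]; exists (x * y); rewrite mulrCA.
Qed.

End Ideals.

(** Lifting the coefficients suffices, the generators coming with preimages; a
    prescribed preimage of y differs from z by an element of the kernel. *)
Lemma ideal_gen_lift (A B : comNzRingType) (phi : {rmorphism A -> B}) s y :
    (forall b, exists x, phi x = b) ->
  ideal_gen [seq phi x | x <- s] y -> exists2 z, ideal_gen s z & phi z = y.
Proof.
move=> surj; elim: s y => [|x s IHs] y.
  case=> c ->; rewrite big_ord0; exists 0; last exact: rmorph0.
  by case: (ideal_gen_is_ideal (@nil A)).
case/ideal_gen_cons=> b [_ /IHs[z sz <-] ->].
have [c <-] := surj b; exists (c * x + z); last by rewrite rmorphD rmorphM.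
by apply/ideal_gen_cons; exists c, z.
Qed.

(** * The quotient by a monic polynomial *)

Section Quotient.
Variables (A : comNzRingType) (f : {poly A}).
Hypotheses (f_monic : f \is monic) (f_gt1 : (1 < size f)%N).

Lemma mk_monicE : mk_monic f = f.
Proof. by rewrite /mk_monic f_gt1 f_monic. Qed.

Lemma in_qpoly_val (v : {poly %/ f}) : in_qpoly f v = v.
Proof. by apply: val_inj; apply: in_qpoly_small; apply: size_mk_monic. Qed.

Lemma in_qpoly_eqP x y :
  in_qpoly f x = in_qpoly f y <-> exists d, x = y + d * f.
Proof.
split=> [/(congr1 val) /= | [d ->]]; last first.
  apply: val_inj; rewrite /= mk_monicE Pdiv.RingMonic.rmodpD //.
  by rewrite Pdiv.RingMonic.rmodp_mull // addr0.
rewrite mk_monicE => xy.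
exists (Pdiv.Ring.rdivp x f - Pdiv.Ring.rdivp y f).
have := Pdiv.RingMonic.rdivp_eq f_monic x; rewrite xy => {1}->.
have := Pdiv.RingMonic.rdivp_eq f_monic y => {2}->.
by ring.
Qed.

End Quotient.

(** * Divisibility by powers of p *)

Section Reduction.
Variables (p a : nat) (R : finComNzRingType) (F : finFieldType).
Variables (mu : {rmorphism R -> F}).
Hypothesis red : reduction p mu.
Hypothesis char_R : forall n : nat, (n%:R == 0 :> R) = (p ^ a %| n)%N.
Hypothesis p_prime : prime p.
Local Notation "x ^mu" := (map_poly mu x) (at level 2, format "x ^mu").

Lemma reduction_kerP x : mu x = 0 <-> exists y, x = p%:R * y.
Proof.
rewrite red.2 ideal_gen1.
by split=> -[y ->]; exists y; rewrite mulrC.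
Qed.

Lemma poly_reduction_ker (x : {poly R}) : x^mu = 0 -> exists y, x = p%:R * y.
Proof.
elim/poly_ind: x => [|x c IHx] x0; first by exists 0; rewrite mulr0.
have mu_coef i : mu (x * 'X + c%:P)`_i = 0 by rewrite -coef_map x0 coef0.
have /IHx[y ->] : x^mu = 0.
  apply/polyP=> i; have := mu_coef i.+1.
  by rewrite coef_map coefD coefMX coefC /= addr0 coef0 => ->.
have := mu_coef 0%N; rewrite coefD coefMX coefC /= add0r.
case/reduction_kerP=> d ->; exists (y * 'X + d%:P).
by rewrite polyCM polyC_natr mulrDr mulrA.
Qed.

Lemma poly_reduction_natp (x : {poly R}) : (p%:R * x)^mu = 0.
Proof.
have mu_p : mu p%:R = 0 by apply/reduction_kerP; exists 1; rewrite mulr1.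
by rewrite rmorphM /= rmorph_nat -polyC_natr -(rmorph_nat mu) mu_p mul0r.
Qed.

(** Otherwise x would be invertible modulo p, and p^e would be a multiple of
    p^(e+1), hence of all higher powers of p, in particular of p^a = 0,
    although p^e is nonzero. *)
Lemma p_torsion (x y : R) e :
  (e < a)%N -> (p ^ e)%:R * x = (p ^ e.+1)%:R * y -> mu x = 0.
Proof.
move=> lt_ea xy; apply/eqP/negPn/negP => mux0.
have [x' x'E] := red.1 (mu x)^-1.
have [z xx'] : exists z, x * x' - 1 = p%:R * z.
  by apply/reduction_kerP; rewrite rmorphB rmorphM rmorph1 /= x'E divff ?subrr.
have stab n : exists w, (p ^ e)%:R = (p ^ (e + n))%:R * w :> R.
  elim: n => [|n [w wE]]; first by exists 1; rewrite addn0 mulr1.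
  have pe : (p ^ e)%:R = (p ^ e.+1)%:R * (y * x' - z) :> R.
    by rewrite mulrBr mulrA -xy expnSr natrM -!mulrA -xx' -mulrBr subKr mulr1.
  (* Multiplying w by the factor found in pe raises the exponent by one. *)
  exists (w * (y * x' - z)).
  rewrite addnS expnS natrM -mulrA [X in _ * X]mulrA -wE.
  by rewrite mulrA -natrM -expnS.
have [w wE] := stab (a - e)%N.
have /eqP pa0 : (p ^ a)%:R == 0 :> R by rewrite char_R.
move: wE; rewrite subnKC ?(ltnW lt_ea) // pa0 mul0r => /eqP.
by rewrite char_R dvdn_Pexp2l ?prime_gt1 // leqNgt lt_ea.
Qed.

Lemma poly_p_torsion (x y : {poly R}) e :
  (e < a)%N -> (p ^ e)%:R * x = (p ^ e.+1)%:R * y -> x^mu = 0.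
Proof.
move=> lt_ea xy; apply/polyP=> i; rewrite coef_map coef0 /=.
have natM n (z : {poly R}) : n%:R * z`_i = (n%:R * z)`_i.
  by rewrite mulr_natl -coefMn mulr_natl.
by apply: (p_torsion (y := y`_i) lt_ea); rewrite !natM xy.
Qed.

(** One factor p at a time: if c = p^n c' and p^(n+1) divides c g, then c' g
    reduces to 0 by p-torsion, hence c' does, F[x] being an integral domain. *)
Lemma p_pow_divides_cofactor (c g w : {poly R}) n :
  (n <= a)%N -> g^mu != 0 -> c * g = (p ^ n)%:R * w ->
  exists c', c = (p ^ n)%:R * c'.
Proof.
move=> le_na g0; elim: n w le_na => [|n IHn] w lt_na cg.
  by exists c; rewrite mul1r.
have [|c' cE] := IHn (p%:R * w) (ltnW lt_na).
  by rewrite cg expnSr natrM mulrA.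
have /eqP : (c' * g)^mu = 0.
  by apply: (poly_p_torsion (y := w) lt_na); rewrite mulrA -cE.
rewrite rmorphM mulf_eq0 (negPf g0) orbF => /eqP/poly_reduction_ker[d dE].
by exists d; rewrite cE dE mulrA -natrM -expnSr.
Qed.

(** The case z = p^(e+1) y of p^e v = c g + z: the factor p^e of c cancels
    modulo p^(e+1). *)
Lemma p_pow_leading (v c g y : {poly R}) e :
    (e < a)%N -> g^mu != 0 -> (p ^ e)%:R * v = c * g + (p ^ e.+1)%:R * y ->
  g^mu %| v^mu.
Proof.
move=> lt_ea g0 vE.
have cg : c * g = (p ^ e)%:R * (v - p%:R * y).
  by rewrite mulrBr vE mulrA -natrM -expnSr addrK.
have [c' cE] := p_pow_divides_cofactor (ltnW lt_ea) g0 cg.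
have /(poly_p_torsion lt_ea)/eqP :
    (p ^ e)%:R * (v - c' * g) = (p ^ e.+1)%:R * y.
  by rewrite mulrBr vE cE mulrA addrC addKr.
by rewrite rmorphB rmorphM subr_eq0 => /eqP->; apply: dvdp_mull.
Qed.

(** * Saturation *)

Section Saturation.
Variable eta : {poly F}.

Definition saturation (I : {poly R} -> Prop) x :=
  exists2 s : {poly R}, coprimep eta s^mu & I (s * x).

Variable I : {poly R} -> Prop.
Hypothesis idI : is_ideal I.

Lemma sub_saturation x : I x -> saturation I x.
Proof. by exists 1; rewrite ?mul1r // rmorph1 coprimep1. Qed.

Lemma saturation_ideal : is_ideal (saturation I).
Proof.
have [I0 ID IM] := idI; split; first exact: sub_saturation.
- move=> x y [s cop_s sx] [s' cop_s' s'y]; exists (s * s').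
    by rewrite rmorphM coprimepMr cop_s.
  by rewrite mulrDr; apply: ID; [rewrite mulrAC mulrC | rewrite -mulrA];
     apply: IM.
- by move=> x y [s cop_s sy]; exists s; rewrite // mulrCA; apply: IM.
Qed.

Lemma saturation_cancel s x :
  coprimep eta s^mu -> saturation I (s * x) -> saturation I x.
Proof.
move=> cop_s [s' cop_s' s'sx]; exists (s' * s); last by rewrite -mulrA.
by rewrite rmorphM coprimepMr cop_s'.
Qed.

End Saturation.

(** * Descent along a generating set in standard form *)

Section Chain.
Variables (f : {poly R}) (eta : {poly F}) (t r : nat) (j k : nat -> nat).
Variable g : nat -> {poly R}.
Hypothesis eta_irr : irreducible_poly eta.
Hypothesis f_mu : f^mu = eta ^+ t.
Hypothesis g_mu : forall i, (i <= r)%N -> (g i)^mu = eta ^+ k i.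
Hypothesis j_lt : forall i, (i < r)%N -> (j i < j i.+1)%N.
Hypothesis j_lt_a : forall i, (i <= r)%N -> (j i < a)%N.
Hypothesis k_lt_t : forall i, (i <= r)%N -> (k i < t)%N.

Local Notation I_ i := (ideal_gen (gens p r j g i)).

Hypothesis chain : forall i, (i < r)%N ->
  exists c, I_ i.+1 ((p ^ j i.+1)%:R * g i - c * f).
Hypothesis top : I_ 0 ((p ^ j 0)%:R * f).

Let S_ i := saturation eta (I_ i).

Lemma gens_cons i : (i <= r)%N ->
  gens p r j g i = (p ^ j i)%:R * g i :: gens p r j g i.+1.
Proof. by move=> le_ir; rewrite /gens subSn // subSS. Qed.

(** For i > r the ideal is zero, so n is arbitrary; thanks to this, the last
    range j r <= e is treated together with the ranges j i <= e < j (i+1). *)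
Lemma gens_multiple i n z : ((i <= r)%N -> (n <= j i)%N) ->
  I_ i z -> exists y, z = (p ^ n)%:R * y.
Proof.
move=> le_n; apply: (ideal_gen_min (multiples_ideal (p ^ n)%:R)).
move=> _ /mapP[l il ->].
have [le_il le_lr] : (i <= l)%N /\ (l <= r)%N.
  move: il; rewrite mem_iota => /andP[le_il lt_l]; split=> //.
  have [le_ir | lt_ri] := leqP i r.+1; first by move: lt_l; rewrite subnKC.
  move: lt_l; rewrite (_ : _ - _ = 0)%N ?addn0 1?ltnNge ?le_il //.
  by apply/eqP; rewrite subn_eq0 ltnW.
have le_jl := leq_of_steps j_lt le_il le_lr.
exists ((p ^ (j l - n))%:R * g l).
rewrite mulrA -natrM -expnD subnKC //.
exact: leq_trans (le_n (leq_trans le_il le_lr)) le_jl.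
Qed.

Let S_ideal i : is_ideal (S_ i).
Proof. exact/saturation_ideal/ideal_gen_is_ideal. Qed.

Let eta_pow_neq0 n : eta ^+ n != 0.
Proof. by rewrite expf_neq0 ?irredp_neq0. Qed.

Let p_powE n m : (n <= m)%N ->
  (p ^ m)%:R = (p ^ (m - n))%:R * (p ^ n)%:R :> {poly R}.
Proof. by move=> le_nm; rewrite -natrM -expnD subnK. Qed.

(** The hypothesis chain expresses p^(j (i+1)) g_i through f, and the membership
    in S_i expresses f through g_i with a coefficient d whose reduction eta
    divides; eliminating f leaves the factor s - d c', whose reduction is prime
    to eta. *)
Lemma saturated_chain_step i : (i < r)%N -> S_ i ((p ^ j i)%:R * f) ->
  S_ i.+1 ((p ^ j i.+1)%:R * g i) /\ S_ i.+1 ((p ^ j i.+1)%:R * f).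
Proof.
move=> lt_ir [s cop_s]; have le_ir := ltnW lt_ir.
have [_ ID IM] := ideal_gen_is_ideal (gens p r j g i.+1).
have [_ SD SM] := S_ideal i.+1.
have lt_j := j_lt lt_ir; have lt_ja := j_lt_a lt_ir.
rewrite gens_cons // => /ideal_gen_cons[d [z Iz sfE]].
have [y zE] := gens_multiple (n := j i.+1) (fun=> leqnn _) Iz.
have pzE : (p ^ (j i.+1 - j i))%:R * z =
    s * ((p ^ j i.+1)%:R * f) - d * ((p ^ j i.+1)%:R * g i).
  have -> : z = s * ((p ^ j i)%:R * f) - d * ((p ^ j i)%:R * g i).
    by rewrite sfE addrAC subrr add0r.
  rewrite (p_powE (ltnW lt_j)); move: (g i) (_ ^ j i)%:R (_ ^ _)%:R => G P Q.
  by ring.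
have eta_d : eta %| d^mu.
  (* p^(j i) (s f - d g_i) = z is a multiple of p^(j (i+1)), and j i < j (i+1),
     so s f - d g_i reduces to 0. *)
  have sf_mu : s^mu * eta ^+ t = d^mu * eta ^+ k i.
    apply/eqP; rewrite -f_mu -(g_mu le_ir) -!rmorphM -subr_eq0 -rmorphB.
    apply/eqP.
    apply: (poly_p_torsion (j_lt_a le_ir)
             (y := (p ^ (j i.+1 - (j i).+1))%:R * y)).
    rewrite mulrA [(p ^ (j i).+1)%:R * _]mulrC -p_powE // -zE.
    by rewrite mulrBr mulrCA sfE mulrCA [_ + z]addrC addrK.
  have <- : s^mu * eta ^+ (t - k i) = d^mu.
    apply: (mulIf (eta_pow_neq0 (k i))).
    by rewrite -mulrA -exprD subnK // ltnW ?k_lt_t.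
  by apply/dvdp_mull/dvdp_exp; rewrite ?subn_gt0 ?k_lt_t.
have Sg : S_ i.+1 ((p ^ j i.+1)%:R * g i).
  have [c Ic] := chain lt_ir.
  have [w wE] := gens_multiple (n := j i.+1) (fun=> leqnn _) Ic.
  have cf : c * f = (p ^ j i.+1)%:R * (g i - w).
    by rewrite mulrBr -wE subKr.
  have [|c' cE] := p_pow_divides_cofactor (ltnW lt_ja) _ cf.
    by rewrite f_mu.
  (* The reduction of s - d c' agrees with that of s modulo eta. *)
  exists (s - d * c').
    rewrite rmorphB rmorphM /=; have [q ->] := dvdpP _ _ eta_d.
    by rewrite -mulrA [eta * _]mulrC mulrA addrC -mulNr coprimep_addl_mul.
  have -> : (s - d * c') * ((p ^ j i.+1)%:R * g i) =
      s * ((p ^ j i.+1)%:R * g i - c * f)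
      + c' * ((p ^ (j i.+1 - j i))%:R * z).
    rewrite pzE cE; set P := (p ^ _)%:R; move: P (g i) => P G; ring.
  by apply: ID; apply: (IM) => //; apply: IM.
split=> //; apply: (saturation_cancel cop_s).
rewrite -[s * _](subrK (d * ((p ^ j i.+1)%:R * g i))) -pzE.
apply: SD; last exact: SM.
exact/sub_saturation/IM.
Qed.

Lemma saturated_multiple i : (i <= r)%N -> S_ i ((p ^ j i)%:R * f).
Proof.
elim: i => [|i IHi] lt_ir; first exact: sub_saturation.
by have [] := saturated_chain_step lt_ir (IHi (ltnW lt_ir)).
Qed.

Lemma saturated_descent i e v : (i < r)%N -> (j i.+1 <= e)%N ->
  S_ i ((p ^ e)%:R * v) -> S_ i.+1 ((p ^ e)%:R * v).
Proof.
move=> lt_ir le_je [s cop_s]; have le_ir := ltnW lt_ir.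
have [_ SD SM] := S_ideal i.+1.
rewrite gens_cons // => /ideal_gen_cons[c [z Iz svE]].
have [y zE] := gens_multiple (n := j i.+1) (fun=> leqnn _) Iz.
have cg : c * (p ^ j i)%:R * g i =
    (p ^ j i.+1)%:R * (s * ((p ^ (e - j i.+1))%:R * v) - y).
  rewrite mulrBr -zE mulrCA [(p ^ j i.+1)%:R * _]mulrA.
  by rewrite [(p ^ j i.+1)%:R * _]mulrC -p_powE // svE addrK mulrA.
have [||c' cE] := p_pow_divides_cofactor _ _ cg.
- exact: ltnW (j_lt_a lt_ir).
- by rewrite g_mu.
apply: (saturation_cancel cop_s); rewrite svE mulrA cE.
apply: SD; last exact/sub_saturation.
rewrite mulrAC mulrC; apply: SM.
by have [] := saturated_chain_step lt_ir (saturated_multiple le_ir).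
Qed.

Section Membership.
Variables (e : nat) (v : {poly R}).
Hypothesis lt_ea : (e < a)%N.
Hypothesis pv_in : exists d, I_ 0 ((p ^ e)%:R * v - d * f).

Lemma torsion_below_first : (e < j 0)%N -> eta ^+ t %| v^mu.
Proof.
move=> lt_ej; have [d Iv] := pv_in.
have [y yE] := gens_multiple (n := e.+1) (fun=> lt_ej) Iv.
rewrite -f_mu; apply: (p_pow_leading (c := d) (y := y) lt_ea).
  by rewrite f_mu.
by rewrite -yE addrC subrK.
Qed.

(** Descending to S_i puts s p^e v in I_i, so that the reduction of g_i divides
    that of s v; s drops out because its reduction is prime to eta. *)
Lemma torsion_from i : (i <= r)%N -> (j i <= e)%N ->
  ((i < r)%N -> (e < j i.+1)%N) -> eta ^+ k i %| v^mu.
Proof.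
move=> le_ir le_je lt_ej.
have Sv l : (l <= r)%N -> (j l <= e)%N -> S_ l ((p ^ e)%:R * v).
  elim: l => [|l IHl] lt_lr le_jle; last first.
    apply: saturated_descent => //; apply: IHl; first exact: ltnW.
    exact: leq_trans (ltnW (j_lt lt_lr)) le_jle.
  have [d Iv] := pv_in.
  have [y yE] := gens_multiple (n := j 0) (fun=> leqnn _) Iv.
  (* By the hypothesis top, d f lies in I_0 once p^(j 0) divides d. *)
  have df : d * f = (p ^ j 0)%:R * ((p ^ (e - j 0))%:R * v - y).
    by rewrite mulrBr -yE mulrA [_ * (p ^ (e - _))%:R]mulrC -p_powE // subKr.
  have [||d' dE] := p_pow_divides_cofactor _ _ df.
  - exact: ltnW (j_lt_a _).
  - by rewrite f_mu.
  have [_ ID IM] := ideal_gen_is_ideal (gens p r j g 0).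
  apply: sub_saturation.
  rewrite -[_ * v](subrK (d * f)); apply: ID => //.
  by rewrite dE mulrAC mulrC; apply: IM.
have [s cop_s] := Sv i le_ir le_je.
rewrite gens_cons // => /ideal_gen_cons[c [z Iz svE]].
have [y zE] := gens_multiple (n := e.+1) lt_ej Iz.
rewrite -(Gauss_dvdpr _ (coprimep_expl (k i) cop_s)) -rmorphM -g_mu //.
apply: (p_pow_leading (c := c * (p ^ j i)%:R) (y := y) lt_ea).
  by rewrite g_mu.
by rewrite mulrCA svE zE mulrA.
Qed.

End Membership.
End Chain.
End Reduction.

(** * Torsional degrees *)

Section TorsionalDegree.
Variables (p : nat) (R : finComNzRingType) (F : finFieldType).
Variables (mu : {rmorphism R -> F}) (f h : {poly R}) (t : nat).
Hypothesis mu_surj : forall y, exists x, mu x = y.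
Hypotheses (f_monic : f \is monic) (f_gt1 : (1 < size f)%N).
Hypothesis h_gt1 : (1 < size (map_poly mu h))%N.
Hypothesis f_mu : map_poly mu f = map_poly mu h ^+ t.

Let fF_monic : map_poly mu f \is monic.
Proof. exact: monic_map. Qed.

Let fF_gt1 : (1 < size (map_poly mu f))%N.
Proof. by rewrite size_map_monic. Qed.

Lemma map_poly_surj (w : {poly F}) : exists x : {poly R}, map_poly mu x = w.
Proof.
elim/poly_ind: w => [|w c [x <-]]; first by exists 0; rewrite rmorph0.
have [d <-] := mu_surj c; exists (x * 'X + d%:P).
by rewrite rmorphD rmorphM /= map_polyX map_polyC.
Qed.

Lemma qreduce_in_qpoly x :
  qreduce mu (in_qpoly f x) = in_qpoly (map_poly mu f) (map_poly mu x).
Proof.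
have /(in_qpoly_eqP f_monic f_gt1)[d {2}->] :
  in_qpoly f x = in_qpoly f (in_qpoly f x) by rewrite in_qpoly_val.
apply/esym/in_qpoly_eqP => //; exists (map_poly mu d).
by rewrite rmorphD rmorphM.
Qed.

(** For exponents up to t the ideals generated by powers of hbar in
    F[x]/(hbar^t) are distinct: T' <= t lets hbar^T' divide the modulus too. *)
Lemma ideal_pow_sub T T' : (T' <= t)%N ->
  ideal_gen [:: in_qpoly (map_poly mu f) (map_poly mu h) ^+ T']
    (in_qpoly (map_poly mu f) (map_poly mu h) ^+ T) -> (T' <= T)%N.
Proof.
move=> le_T't /ideal_gen1[c]; rewrite -(in_qpoly_val c) -!rmorphXn -rmorphM.
case/(in_qpoly_eqP fF_monic fF_gt1)=> d.
rewrite !rmorphXn /= => hE.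
rewrite -(dvdp_Pexp2l _ _ h_gt1) hE.
apply: dvdp_add; apply: dvdp_mull => //.
by rewrite f_mu dvdp_exp2l.
Qed.

(** The element x shows that the torsion ideal contains hbar^T, the divisibility
    that it contains nothing more; T is unique because it is determined by the
    ideal that hbar^T generates. *)
Lemma torsional_degreeP (C : {poly %/ f} -> Prop) (idC : is_ideal C) e T :
    (T <= t)%N ->
    (exists2 x, C (in_qpoly f ((p ^ e)%:R * x)) &
       map_poly mu x = map_poly mu h ^+ T) ->
    (forall v, C (in_qpoly f ((p ^ e)%:R * v)) ->
       map_poly mu h ^+ T %| map_poly mu v) ->
  torsional_degree p mu h t C e T.
Proof.
move=> le_Tt [x Cx x_mu] dvd_T; have [_ _ CM] := idC.
have TorE (w : {poly %/ map_poly mu f}) : Tor p C e w <->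
    ideal_gen [:: in_qpoly (map_poly mu f) (map_poly mu h) ^+ T] w.
  split=> [[v Cv ->] | /ideal_gen1[c ->]].
    have /dvdpP[q qE] : map_poly mu h ^+ T %| map_poly mu v.
      by apply: dvd_T; rewrite rmorphM rmorph_nat /= in_qpoly_val.
    apply/ideal_gen1; exists (in_qpoly _ q).
    by rewrite /qreduce qE rmorphM rmorphXn.
  have [y yE] := map_poly_surj c; exists (in_qpoly f (y * x)).
    rewrite -(rmorph_nat (in_qpoly f)) -rmorphM mulrCA rmorphM.
    exact: CM.
  rewrite qreduce_in_qpoly (rmorphM (map_poly mu)) /= yE x_mu.
  by rewrite rmorphM rmorphXn /= in_qpoly_val.
split=> [|T' [le_T't TorE']]; first by split.
apply/eqP; rewrite eqn_leq; apply/andP; split.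
  apply: ideal_pow_sub => //; apply/TorE/TorE'/mem_ideal_gen.
  by rewrite mem_head.
apply: ideal_pow_sub => //; apply/TorE'/TorE/mem_ideal_gen.
by rewrite mem_head.
Qed.

End TorsionalDegree.

Theorem theorem3p16 (p a m : nat) (R : finComNzRingType) (F : finFieldType)
    (mu : {rmorphism R -> F}) (zeta : R) (f h beta : {poly R}) (t : nat)
    (standing : standing_assumption p a m mu zeta f h beta t)
    (C : {poly %/ f} -> Prop) (idealC : is_ideal C)
    (r : nat) (j k : nat -> nat) (g : nat -> {poly R})
    (std : standard_form p a h t C r j k g)
    (b : nat -> {poly %/ f})
    (gE : forall i, (i <= r)%N ->
       in_qpoly f (g i) = in_qpoly f h ^+ k i + p%:R * b i)
    (e : nat) (le_e : (e <= a.-1)%N) :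
  [/\ (e < j 0)%N -> torsional_degree p mu h t C e t,
      forall i, (i < r)%N -> (j i <= e < j i.+1)%N ->
        torsional_degree p mu h t C e (k i)
    & (j r <= e)%N -> torsional_degree p mu h t C e (k r)].
Proof.
case: standing => -[p_prime a_gt0 _ char_R _ _] _ red _ f_monic _ _ _ t_gt0.
move=> _ [_ h_irr] _ _ fE.
case: std => _ genC j_lt j_le k_lt k_gt form chain top.
have lt_a n : (n <= a.-1)%N = (n < a)%N by rewrite -ltnS prednK.
have f_mu : map_poly mu f = map_poly mu h ^+ t.
  by rewrite fE rmorphD /= (poly_reduction_natp red) addr0 rmorphXn.
have h_gt1 : (1 < size (map_poly mu h))%N by case: h_irr.
have f_gt1 : (1 < size f)%N.
  rewrite -(size_map_monic mu f_monic) f_mu -ltn_predRL size_exp.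
  by rewrite muln_gt0 ltn_predRL h_gt1.
have g_mu i : (i <= r)%N -> map_poly mu (g i) = map_poly mu h ^+ k i.
  move=> /form[s [alpha [-> _]]]; rewrite rmorphD rmorphXn rmorph_sum /=.
  rewrite big_nat big1 ?addr0 // => l /andP[l_gt0 _].
  by rewrite -(prednK l_gt0) expnS natrM -!mulrA (poly_reduction_natp red).
have j_lt_a i : (i <= r)%N -> (j i < a)%N.
  move=> le_ir; rewrite -lt_a; apply: leq_trans j_le.
  exact: leq_of_steps j_lt le_ir (leqnn r).
have k_lt_t i : (i <= r)%N -> (k i < t)%N.
  elim: i => // i IHi lt_ir.
  exact: ltn_trans (k_gt _ lt_ir) (IHi (ltnW lt_ir)).
have surj c : exists x, in_qpoly f x = c by exists c; apply: in_qpoly_val.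
have lift s x : ideal_gen [seq in_qpoly f q | q <- s] (in_qpoly f x) ->
    exists d, ideal_gen s (x - d * f).
  case/(ideal_gen_lift surj)=> z sz /esym/(in_qpoly_eqP f_monic f_gt1)[d ->].
  by exists d; rewrite addrK.
have chainP i : (i < r)%N ->
    exists c, ideal_gen (gens p r j g i.+1) ((p ^ j i.+1)%:R * g i - c * f).
  by move=> /chain/lift.
have C_lift v : C (in_qpoly f v) ->
    exists d, ideal_gen (gens p r j g 0) (v - d * f).
  by move/genC/lift.
have lt_ea : (e < a)%N by rewrite -lt_a.
have middle i : (i <= r)%N -> (j i <= e)%N -> ((i < r)%N -> (e < j i.+1)%N) ->
    torsional_degree p mu h t C e (k i).
  move=> le_ir le_je lt_ej.
  apply: (torsional_degreeP red.1 f_monic f_gt1 h_gt1 f_mu idealC) => //.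
  - exact: ltnW (k_lt_t _ _).
  - exists (g i); last exact: g_mu.
    have [_ _ CM] := idealC.
    rewrite -(subnK le_je) expnD natrM -mulrA rmorphM; apply: CM.
    apply/genC/mem_ideal_gen/map_f/mapP; exists i => //.
    by rewrite mem_iota /= add0n subn0 ltnS.
  - move=> v /C_lift Iv.
    exact: (torsion_from red char_R p_prime h_irr f_mu g_mu j_lt j_lt_a
      k_lt_t chainP top lt_ea Iv le_ir le_je lt_ej).
split=> [lt_ej | i lt_ir /andP[le_je lt_ej] | le_je].
- apply: (torsional_degreeP red.1 f_monic f_gt1 h_gt1 f_mu idealC) => //.
  + exists f => //; have [C0 _ _] := idealC.
    suff -> : in_qpoly f ((p ^ e)%:R * f) = 0 by [].
    rewrite -(rmorph0 (in_qpoly f)); apply/in_qpoly_eqP => //.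
    by exists (p ^ e)%:R; rewrite add0r.
  + move=> v /C_lift Iv.
    exact: (torsion_below_first red char_R p_prime h_irr f_mu j_lt lt_ea Iv
      lt_ej).
- exact: middle (ltnW lt_ir) le_je (fun=> lt_ej).
- by apply: middle => //; rewrite ltnn.
Qed.
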